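(* Fix any $p\in\mathbb{N}$ and $\alpha>0$. Suppose $\mathcal{A}$ is a PAP query-release algorithm for the class $\mathcal{S}_p$ of binary decision stumps on $\{\pm1\}^p$ that takes $n$ private samples and $m$ public samples, is $(1,1/(4n))$-differentially private with respect to its private samples (for every fixed public dataset), and is $(\alpha,\alpha)$-accurate for $\mathcal{S}_p$. Then either $n=\tilde\Omega(\sqrt{p}/\alpha)$ or $m=\Omega(1/\alpha^2)$, where the implied constants and polylogarithmic factors are universal (independent of $p$, $\alpha$ and $\mathcal{A}$).
   Context: The class of binary decision stumps $\mathcal{S}_p$ consists of the functions $h_i:\{\pm1\}^p\to\{\pm1\}$, $h_i(x)=x_i$, for $i\in[p]$. A PAP query-release algorithm takes a private dataset $\vec x\in\mathcal{X}^n$ and a public dataset $\vec w\in\mathcal{X}^m$ (here $\mathcal{X}=\{\pm1\}^p$) and outputs $G:\mathcal{S}_p\to[-1,1]$. It is $(\alpha,\beta)$-accurate if for every distribution $\mathbf{D}$ on $\mathcal{X}$, with $\vec x\sim\mathbf{D}^n$, $\vec w\sim\mathbf{D}^m$, with probability at least $1-\beta$ the output satisfies $\sup_{h\in\mathcal{S}_p}|G(h)-\mathbb{E}_{x\sim\mathbf{D}}[h(x)]|\le\alpha$. It is $(\varepsilon,\delta)$-differentially private with respect to its private samples if for every fixed $\vec w$, for all private datasets $\vec x,\vec x'$ differing in one element and all output sets $Z$, $\Pr[\mathcal{A}(\vec x,\vec w)\in Z]\le e^{\varepsilon}\Pr[\mathcal{A}(\vec x',\vec w)\in Z]+\delta$.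 The notation $\tilde\Omega$ hides polylogarithmic factors.
   Formalization: The bound is stated for α at most some universal constant α₀ > 0 rather than for every α > 0; for α ≥ 1 the constant-zero algorithm with n = 1, m = 0 is private and accurate, so the claim fails there for large p. *)

(* Defs.v *)
From HB Require Import structures.
From mathcomp Require Import all_boot all_order all_algebra.
From mathcomp Require Import all_classical all_reals all_analysis.
From mathcomp Require Import Rstruct Rstruct_topology.
Set Implicit Arguments. Unset Strict Implicit. Unset Printing Implicit Defensive.
Import Order.TTheory GRing.Theory Num.Theory.
Local Open Scope classical_set_scope.
Local Open Scope ring_scope.

Notation RR := Rdefinitions.R.

(* The domain X = {+-1}^p, with true encoding +1 and false encoding -1. *)
Definition Cube (p : nat) := {ffun 'I_p -> bool}.

Definition stump (p : nat) (i : 'I_p) (x : Cube p) : RR := if x i then 1 else -1.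

Definition is_distr (p : nat) (D : Cube p -> RR) : Prop :=
  (forall x, 0 <= D x) /\ \sum_(x : Cube p) D x = 1.

Definition stump_mean (p : nat) (D : Cube p -> RR) (i : 'I_p) : RR :=
  \sum_(x : Cube p) D x * stump i x.

Definition Dataset (p n : nat) := {ffun 'I_n -> Cube p}.

Definition prodD (p n : nat) (D : Cube p -> RR) (x : Dataset p n) : RR :=
  \prod_(j < n) D (x j).

(* Outputs G : S_p -> R, identified with functions 'I_p -> R (G(h_i) = G i),
   with the product (Borel) sigma-algebra generated by the coordinate maps. *)
Definition cylinders (p : nat) : set (set ('I_p -> RR)) :=
  fun A => exists (i : 'I_p) (B : set RR), @measurable _ (measurableTypeR RR) B /\ A = (fun G => G i) @^-1` B.

Definition Out (p : nat) := g_sigma_algebraType (@cylinders p).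

(* A randomized PAP algorithm: for each private dataset x (n samples) and public
   dataset w (m samples), a probability distribution over outputs. *)
Definition PAPAlg (p n m : nat) := Dataset p n -> Dataset p m -> probability (Out p) RR.

Definition outputs_in_range (p n m : nat) (A : PAPAlg p n m) : Prop :=
  forall x w, A x w [set G : Out p | forall i, -1 <= G i <= 1] = 1%E.

Definition neighbors (p n : nat) (x x' : Dataset p n) : Prop :=
  exists i : 'I_n, forall j : 'I_n, j != i -> x j = x' j.

Definition DP_private (p n m : nat) (A : PAPAlg p n m) (eps delta : RR) : Prop :=
  forall (w : Dataset p m) (x x' : Dataset p n), neighbors x x' ->
  forall Z : set (Out p), measurable Z ->
    (A x w Z <= (expR eps)%:E * A x' w Z + delta%:E)%E.

Definition accurate_event (p : nat) (D : Cube p -> RR) (alpha : RR) : set (Out p) :=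
  [set G : Out p | forall i, `|G i - stump_mean D i| <= alpha].

Definition accurate (p n m : nat) (A : PAPAlg p n m) (alpha beta : RR) : Prop :=
  forall D : Cube p -> RR, is_distr D ->
  ((1 - beta)%:E <=
     \sum_(x : Dataset p n) \sum_(w : Dataset p m)
        (prodD D x * prodD D w)%:E * A x w (accurate_event D alpha))%E.

(* Main.v *)
(* Only the signs of the released means matter. Take product distributions whose
   means mu_i range over a grid of [-2 alpha, 2 alpha]. Accuracy forces the
   expected sign of the i-th answer to go from about -1 to about 1 along the i-th
   axis. Each grid step changes the law of the data by a likelihood ratio close to
   1 + h * (sum over all samples of the score), so averaging over the grid gives a
   mu at which the correlations of the answer signs with the total scores add up to
   at least p / (4 alpha). The public samples contribute at most about p sqrt m to
   this sum, which is too little if m is below a small multiple of 1 / alpha^2. By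
   privacy each private sample contributes about as much as an independent fresh
   sample would, that is O(sqrt p) plus the delta term. Hence n is at least a
   multiple of sqrt p / alpha, without logarithmic loss. *)
Require Import Defs.
From HB Require Import structures.
From mathcomp Require Import all_boot all_order all_algebra.
From mathcomp Require Import all_classical all_reals all_analysis.
From mathcomp Require Import Rstruct Rstruct_topology.
From mathcomp Require Import ring lra.
Import Order.TTheory GRing.Theory Num.Theory.
Set Implicit Arguments. Unset Strict Implicit. Unset Printing Implicit Defensive.
Local Open Scope classical_set_scope.
Local Open Scope ring_scope.

(** * Product weights on finite function spaces *)

Definition upd (I : finType) (T : Type) (x : {ffun I -> T}) (i : I) (t : T) :
  {ffun I -> T} := [ffun j => if j == i then t else x j].

Definition prodp (R : realFieldType) (I T : finType) (P : I -> T -> R)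
  (x : {ffun I -> T}) : R := \prod_i P i (x i).

Section FiniteProduct.
Context {R : realFieldType} {I T : finType}.
Variable P : I -> T -> R.

Lemma prodp_ge0 : (forall i t, 0 <= P i t) -> forall x, 0 <= prodp P x.
Proof. by move=> P0 x; apply: prodr_ge0. Qed.

Lemma sum_prodp : (forall i, \sum_t P i t = 1) -> \sum_x prodp P x = 1.
Proof.
move=> P1; rewrite /prodp -(bigA_distr_bigA (fun i t => P i t)).
by apply: big1 => i _; exact: P1.
Qed.

Lemma prodp_upd (x : {ffun I -> T}) (i : I) (t : T) :
  prodp P (upd x i t) * P i (x i) = prodp P x * P i t.
Proof.
rewrite /prodp (bigD1 i) //= (bigD1 (F := fun j => P j (x j)) i) //=.
rewrite ffunE eqxx.
rewrite (eq_bigr (fun j => P j (x j))); first by ring.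
by move=> j ji; rewrite ffunE (negbTE ji).
Qed.

(* Exchanging the [i]-th coordinate with an independent copy of it preserves
   the joint law; this is the only form of independence used below. *)
Lemma resample (f : {ffun I -> T} -> T -> R) (i : I) :
  \sum_x \sum_t prodp P x * P i t * f (upd x i t) (x i) =
  \sum_x \sum_t prodp P x * P i t * f x t.
Proof.
rewrite !pair_bigA /=.
pose s (y : {ffun I -> T} * T) := (upd y.1 i y.2, y.1 i).
have sK : involutive s.
  case=> x t; rewrite /s /=; congr (_, _); last by rewrite ffunE eqxx.
  by apply/ffunP => j; rewrite !ffunE; case: eqVneq => // ->.
rewrite [RHS](reindex_inj (inv_inj sK)) /=.
by apply: eq_bigr => -[x t] _ /=; rewrite prodp_upd.
Qed.

Hypothesis P1 : forall i, \sum_t P i t = 1.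

(** Since [g] ignores coordinate [i], a fresh copy [t] can be written into it for free; [resample]
    then swaps [t] with [x i], and the sums separate. *)
Lemma sum_prodp_indep (g : {ffun I -> T} -> R) (v : T -> R) (i : I) :
  (forall x t, g (upd x i t) = g x) ->
  \sum_x prodp P x * (g x * v (x i)) =
  (\sum_x prodp P x * g x) * \sum_t P i t * v t.
Proof.
move=> gi; rewrite mulr_suml.
transitivity (\sum_x \sum_t prodp P x * P i t * (g (upd x i t) * v (x i))).
  apply: eq_bigr => x _; under eq_bigr do rewrite gi mulrAC.
  by rewrite -mulr_sumr P1 mulr1.
rewrite (resample (fun x t => g x * v t)); apply: eq_bigr => x _.
by rewrite mulr_sumr; apply: eq_bigr => t _; ring.
Qed.

Lemma sum_prodp_marginal (v : T -> R) (i : I) :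
  \sum_x prodp P x * v (x i) = \sum_t P i t * v t.
Proof.
have := @sum_prodp_indep (fun=> 1) v i (fun _ _ => erefl).
under eq_bigr do rewrite mul1r.
by under [X in X * _]eq_bigr do rewrite mulr1; rewrite sum_prodp // mul1r.
Qed.

(** The cross terms of the square vanish: for [j] other than [i], [v j (x j)] does not depend on
    coordinate [i], where [v i] has mean zero. *)
Lemma sum_prodp_sqr (v : I -> T -> R) :
  (forall i, \sum_t P i t * v i t = 0) ->
  \sum_x prodp P x * (\sum_i v i (x i)) ^+ 2 =
  \sum_i \sum_t P i t * v i t ^+ 2.
Proof.
move=> v0.
under eq_bigr => x _ do rewrite expr2 mulr_suml mulr_sumr.
rewrite exchange_big; apply: eq_bigr => i _ /=.
rewrite -(sum_prodp_marginal (fun t => v i t ^+ 2) i).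
apply/eqP; rewrite -subr_eq0 -sumrB; apply/eqP.
under eq_bigr => x _ do rewrite (bigD1 i) //= mulrDr mulrDr expr2 addrAC subrr add0r.
under eq_bigr => x _ do rewrite !mulr_sumr.
rewrite exchange_big big1 //= => j ji.
under eq_bigr => x _ do rewrite (mulrC (v i _)).
rewrite (sum_prodp_indep (g := fun x : {ffun I -> T} => v j (x j))) ?v0 ?mulr0 // => x t.
by rewrite ffunE (negbTE ji).
Qed.

End FiniteProduct.

(** This is [resample] with all weights 1. It turns sums along the lines of a grid in direction [i]
    into a sum over the whole grid. *)
Lemma sum_upd (R : realFieldType) (I T : finType) (f : {ffun I -> T} -> R) (i : I) :
  \sum_x \sum_t f (upd x i t) = #|T|%:R * \sum_x f x.
Proof.
have := @resample R I T (fun _ _ => 1) (fun x _ => f x) i.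
have p1 (x : {ffun I -> T}) : prodp (fun=> fun=> 1 : R) x = 1 by rewrite /prodp big1.
under eq_bigr => x _ do under eq_bigr => t _ do rewrite p1 !mul1r.
under [RHS]eq_bigr => x _ do under eq_bigr => t _ do rewrite p1 !mul1r.
move=> ->; rewrite mulr_sumr; apply: eq_bigr => x _.
by rewrite sumr_const mulr_natl.
Qed.

(** * Elementary inequalities *)

Lemma expr1D_le (R : realFieldType) (a : R) (k : nat) :
  0 <= a -> k%:R * a <= 1 -> (1 + a) ^+ k <= 1 + k%:R * a + (k%:R * a) ^+ 2.
Proof.
move=> a0; elim: k => [|k IH] ka; first by rewrite expr0 mul0r expr0n /= !addr0.
rewrite -natr1 in ka *.
have k0 : 0 <= k%:R :> R by [].
have {IH} := IH (le_trans _ ka) => /(_ _); rewrite mulrDl mul1r => IH.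
have {}IH : (1 + a) ^+ k <= 1 + k%:R * a + (k%:R * a) ^+ 2 by apply: IH; lra.
rewrite exprSr; apply: le_trans (ler_wpM2r _ IH) _; first by lra.
set K := k%:R in ka k0 *.
(* The only cubic term of the product is K^2 a^3; as K a <= 1, it fits into the term 2 K a^2 gained
   by the square on the right. *)
have : K * a * (K * a ^+ 2) <= K * a ^+ 2 by rewrite ler_piMl ?mulr_ge0 ?sqr_ge0; nra.
nra.
Qed.

(* Linearisation of a likelihood ratio, a product of factors close to 1. *)
Lemma prod1D_linear (R : realFieldType) (a : R) (s : seq R) :
  0 <= a -> {in s, forall v, `|v| <= a} ->
  `|\prod_(v <- s) (1 + v) - 1| <= (1 + a) ^+ size s - 1 /\
  `|\prod_(v <- s) (1 + v) - 1 - \sum_(v <- s) v|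
    <= (1 + a) ^+ size s - 1 - (size s)%:R * a.
Proof.
move=> a0; elim: s => [|v s IH] vs.
  by rewrite !big_nil /= expr0 !subrr mul0r subrr normr0.
have va : `|v| <= a by apply: vs; rewrite inE eqxx.
have {}IH := IH (fun u us => vs u (mem_behead (s := v :: s) us)).
case: IH; rewrite !big_cons /= exprS -natr1.
set Q := \prod_(_ <- _) _; set S := \sum_(_ <- _) _; set A := _ ^+ _; set k := _%:R.
move=> H1 H2.
have H3 : `|v * (Q - 1)| <= a * (A - 1) by rewrite normrM ler_pM.
split.
  have -> : (1 + v) * Q - 1 = v + (Q - 1) + v * (Q - 1) by ring.
  by apply: le_trans (ler_normD _ _) _; have := ler_normD v (Q - 1); lra.
have -> : (1 + v) * Q - 1 - (v + S) = (Q - 1 - S) + v * (Q - 1) by ring.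
by apply: le_trans (ler_normD _ _) _; lra.
Qed.

Lemma dp_expectation (R : realFieldType) (B : finType) (q q' : B -> R)
    (e d M : R) (phi : B -> R) :
  (forall Z : {set B}, \sum_(b in Z) q b <= e * (\sum_(b in Z) q' b) + d) ->
  0 <= M -> (forall b, 0 <= phi b <= M) ->
  \sum_b q b * phi b <= e * (\sum_b q' b * phi b) + d * M.
Proof.
move=> dp M0 phiM; pose Z := [set b | e * q' b <= q b]%SET.
rewrite addrC -lerBlDr mulr_sumr -sumrB.
apply: (@le_trans _ _ (\sum_(b in Z) (q b - e * q' b) * M)); last first.
  by rewrite -mulr_suml ler_wpM2r // sumrB -mulr_sumr lerBlDr addrC dp.
rewrite [leRHS]big_mkcond; apply: ler_sum => b _; rewrite inE.
have /andP[p0 pM] := phiM b.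
by case: ifPn => [le|]; [|rewrite -ltNge => lt]; nra.
Qed.

(* AM-GM replaces Cauchy-Schwarz: [2 |y| <= l y^2 + 1 / l]. *)
Lemma sum_norm_le_sqr (R : realFieldType) (B : finType) (P Y : B -> R) (l V : R) :
  (forall b, 0 <= P b) -> \sum_b P b = 1 -> 0 < l ->
  \sum_b P b * Y b ^+ 2 <= V ->
  \sum_b P b * `|Y b| <= (l * V + l^-1) / 2.
Proof.
move=> P0 P1 l0 PV.
apply: (@le_trans _ _ (\sum_b P b * ((l * Y b ^+ 2 + l^-1) / 2))).
  apply: ler_sum => b _; apply: ler_wpM2l => //.
  have <- : `|Y b| ^+ 2 = Y b ^+ 2 by rewrite real_normK ?num_real.
  set y := `|_|; rewrite ler_pdivlMr // -subr_ge0.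
  have -> : l * y ^+ 2 + l^-1 - y * 2 = l^-1 * (l * y - 1) ^+ 2.
    by field; rewrite gt_eqF.
  by rewrite mulr_ge0 ?sqr_ge0 ?invr_ge0 ?ltW.
under eq_bigr => b _.
  have -> : P b * ((l * Y b ^+ 2 + l^-1) / 2) =
     (l / 2) * (P b * Y b ^+ 2) + l^-1 / 2 * P b by field; rewrite gt_eqF.
  over.
rewrite big_split /= -!mulr_sumr P1 mulr1 mulrDl lerD2r.
by have := ler_wpM2l (ltW l0) PV; set y := \sum_b _; lra.
Qed.

(** * Expectations over the private and public samples *)

Section Samples.
Context {R : realFieldType} {T : finType} {n m : nat}.
Implicit Types (D : T -> R) (f g : {ffun 'I_n -> T} -> {ffun 'I_m -> T} -> R).

Definition esp D f : R :=
  \sum_x \sum_w prodp (fun=> D) x * prodp (fun=> D) w * f x w.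

Lemma esp_sum D (I : finType) (F : I -> {ffun 'I_n -> T} -> {ffun 'I_m -> T} -> R) :
  esp D (fun x w => \sum_i F i x w) = \sum_i esp D (F i).
Proof.
rewrite /esp [RHS]exchange_big; apply: eq_bigr => x _ /=.
by rewrite [RHS]exchange_big; apply: eq_bigr => w _; rewrite mulr_sumr.
Qed.

Lemma espD D f g : esp D (fun x w => f x w + g x w) = esp D f + esp D g.
Proof.
rewrite /esp -big_split; apply: eq_bigr => x _ /=.
by rewrite -big_split; apply: eq_bigr => w _; rewrite mulrDr.
Qed.

Lemma espZ D (c : R) f : esp D (fun x w => c * f x w) = c * esp D f.
Proof.
rewrite /esp mulr_sumr; apply: eq_bigr => x _ /=.
by rewrite mulr_sumr; apply: eq_bigr => w _; ring.
Qed.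

Section Distribution.
Variable D : T -> R.
Hypotheses (D0 : forall z, 0 <= D z) (D1 : \sum_z D z = 1).

Lemma esp_le f g : (forall x w, f x w <= g x w) -> esp D f <= esp D g.
Proof.
move=> fg; apply: ler_sum => x _; apply: ler_sum => w _.
by rewrite ler_wpM2l // mulr_ge0 // prodp_ge0.
Qed.

Lemma esp_private (f : {ffun 'I_n -> T} -> R) :
  esp D (fun x _ => f x) = \sum_x prodp (fun=> D) x * f x.
Proof.
apply: eq_bigr => x _; rewrite -mulr_suml -mulr_sumr.
by rewrite (sum_prodp (fun=> D1)) mulr1.
Qed.

Lemma esp_public (f : {ffun 'I_m -> T} -> R) :
  esp D (fun _ w => f w) = \sum_w prodp (fun=> D) w * f w.
Proof.
rewrite /esp exchange_big; apply: eq_bigr => w _ /=.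
by rewrite -!mulr_suml (sum_prodp (fun=> D1)) mul1r.
Qed.

Lemma esp_cst (c : R) : esp D (fun _ _ => c) = c.
Proof. by rewrite esp_private -mulr_suml (sum_prodp (fun=> D1)) mul1r. Qed.

Lemma esp_norm_le f (r : R) : (forall x w, `|f x w| <= r) -> `|esp D f| <= r.
Proof.
move=> fr; rewrite ler_norml; apply/andP; split.
  rewrite -[leLHS]esp_cst; apply: esp_le => x w.
  by have := fr x w; rewrite ler_norml => /andP[].
rewrite -[leRHS]esp_cst; apply: esp_le => x w.
by have := fr x w; rewrite ler_norml => /andP[].
Qed.

(** Passing from [D] to [D'] multiplies the weight of the two samples by a product of n + m factors
    [1 + v]. [prod1D_linear], applied to the concatenated list of all these [v], bounds the error of
    linearising it. *)
Lemma esp_likelihood (D' v : T -> R) (a : R) f :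
  0 <= a -> (forall z, `|v z| <= a) -> (forall z, D' z = D z * (1 + v z)) ->
  (forall x w, `|f x w| <= 1) ->
  `|esp D' f - esp D f
    - esp D (fun x w => f x w * (\sum_j v (x j) + \sum_j v (w j)))| <=
  (1 + a) ^+ (n + m) - 1 - (n + m)%:R * a.
Proof.
move=> a0 va D'E f1.
pose lr k (x : {ffun 'I_k -> T}) := \prod_j (1 + v (x j)).
have D'prod k (x : {ffun 'I_k -> T}) :
    prodp (fun=> D') x = prodp (fun=> D) x * lr k x.
  by rewrite /prodp -big_split; apply: eq_bigr => j _; rewrite D'E.
have -> : esp D' f - esp D f
    - esp D (fun x w => f x w * (\sum_j v (x j) + \sum_j v (w j))) =
  esp D (fun x w => f x w *
     (lr n x * lr m w - 1 - (\sum_j v (x j) + \sum_j v (w j)))).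
  rewrite /esp -!sumrB; apply: eq_bigr => x _; rewrite -!sumrB.
  by apply: eq_bigr => w _; rewrite !D'prod; ring.
apply: esp_norm_le => x w; rewrite normrM -[leRHS]mul1r ler_pM //.
pose s := [seq v (x j) | j : 'I_n] ++ [seq v (w j) | j : 'I_m].
have sa : {in s, forall u, `|u| <= a}.
  by move=> u; rewrite mem_cat => /orP[] /mapP[j _ ->]; exact: va.
have [_] := prod1D_linear a0 sa.
by rewrite size_cat !size_image !card_ord !big_cat !big_image.
Qed.

End Distribution.
End Samples.

(** * Biased signs and product distributions on the cube *)

Definition sg (b : bool) : RR := if b then 1 else -1.

Lemma sg_norm b : `|sg b| = 1.
Proof. by case: b; rewrite /= ?normrN normr1. Qed.

Definition bern (t : RR) (b : bool) : RR := (1 + t * sg b) / 2.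

(* The logarithmic derivative in [t] of [bern t b]. *)
Definition score (t : RR) (b : bool) : RR := sg b / (1 + t * sg b).

Definition cubeD (p : nat) (mu : 'I_p -> RR) : Cube p -> RR :=
  prodp (fun i b => bern (mu i) b).

Lemma sum_bern (t : RR) : \sum_b bern t b = 1.
Proof. by rewrite big_bool /bern /=; field. Qed.

Lemma bern_ge0 (t : RR) b : `|t| <= 1 -> 0 <= bern t b.
Proof. by rewrite ler_norml /bern => /andP[]; case: b => /=; lra. Qed.

(** As [bern] is affine in [t], the first-order expansion is exact; the bound on [t] keeps the
    denominator of the score away from 0. *)
Lemma bernD (t h : RR) b :
  `|t| <= 1 / 2 -> bern (t + h) b = bern t b * (1 + h * score t b).
Proof.
by rewrite ler_norml /bern /score => /andP[]; case: b => /= ? ?; field; lra.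
Qed.

Lemma score_norm (t : RR) b : `|t| <= 1 / 2 -> `|score t b| <= 2.
Proof.
rewrite ler_norml => /andP[t0 t1]; rewrite /score normrM normfV.
have d0 : 1 / 2 <= 1 + t * sg b by case: b => /=; lra.
by rewrite sg_norm mul1r ger0_norm ?lef_pV2; [rewrite invf_ple ?posrE; lra|lra].
Qed.

Lemma sum_bern_score (t : RR) : `|t| <= 1 / 2 -> \sum_b bern t b * score t b = 0.
Proof.
rewrite ler_norml => /andP[? ?]; rewrite big_bool /bern /score /=; field.
by apply/andP; split; lra.
Qed.

(** The left side is the Fisher information 1 / (1 - t^2), which is at most 4/3 here. *)
Lemma sum_bern_score_sqr (t : RR) :
  `|t| <= 1 / 2 -> \sum_b bern t b * score t b ^+ 2 <= 2.
Proof.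
rewrite ler_norml => /andP[t0 t1]; rewrite big_bool /bern /score /=.
have -> : (1 + t * 1) / 2 * (1 / (1 + t * 1)) ^+ 2 +
  (1 + t * -1) / 2 * (-1 / (1 + t * -1)) ^+ 2 = ((1 + t) * (1 - t))^-1.
  by field; apply/andP; split; lra.
by rewrite invf_ple ?posrE; nra.
Qed.

Section CubeD.
Variables (p : nat) (mu : 'I_p -> RR).

Lemma sum_cubeD : \sum_z cubeD mu z = 1.
Proof. by apply: sum_prodp => i; exact: sum_bern. Qed.

Lemma cubeD_marginal (v : bool -> RR) i :
  \sum_z cubeD mu z * v (z i) = \sum_b bern (mu i) b * v b.
Proof. by apply: (sum_prodp_marginal (fun i => sum_bern (mu i))). Qed.

Lemma cubeD_mean i : stump_mean (cubeD mu) i = mu i.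
Proof. by rewrite /stump_mean (cubeD_marginal sg) big_bool /bern /=; field. Qed.

Lemma cubeD_is_distr : (forall i, `|mu i| <= 1) -> is_distr (cubeD mu).
Proof.
move=> mu1; split; last exact: sum_cubeD.
by move=> z; apply: prodp_ge0 => i b; apply: bern_ge0.
Qed.

Lemma cubeD_shift (mu' : 'I_p -> RR) (i : 'I_p) (h : RR) z :
  `|mu i| <= 1 / 2 -> mu' i = mu i + h -> (forall j, j != i -> mu' j = mu j) ->
  cubeD mu' z = cubeD mu z * (1 + h * score (mu i) (z i)).
Proof.
move=> mui mu'i mu'E; rewrite /cubeD /prodp (bigD1 i) //= [in RHS](bigD1 i) //=.
rewrite mu'i bernD // mulrAC; congr (_ * _ * _).
by apply: eq_bigr => j ji; rewrite mu'E.
Qed.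

End CubeD.

(** * Fingerprinting by averaging over a grid of means *)

(** This is the logarithmic derivative in [mu i] of the joint law of both samples. *)
Definition sample_score (p n m : nat) (mu : 'I_p -> RR) (i : 'I_p)
    (x : Dataset p n) (w : Dataset p m) : RR :=
  \sum_j score (mu i) (x j i) + \sum_j score (mu i) (w j i).

Lemma sumr_ge0_ex (R : realFieldType) (I : finType) (i0 : I) (F : I -> R) :
  0 <= \sum_i F i -> exists i, 0 <= F i.
Proof.
move=> S0; apply/existsP; apply: contraLR S0 => /existsPn F0; rewrite -ltNge.
rewrite (bigD1 i0) //= -[ltRHS]addr0 ltr_leD //; first by rewrite ltNge F0.
by apply: sumr_le0 => i _; rewrite ltW // ltNge F0.
Qed.

Lemma fine_grid (k : nat) : exists2 N, (0 < N)%N &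
  forall a : RR, 0 <= a -> a * N%:R <= 2 ->
    N%:R * ((1 + a) ^+ k - 1 - k%:R * a) <= 1 / 2.
Proof.
(* The total error over N steps is at most N (k a)^2 <= 4 k^2 / N, which 8 k^2 makes at most 1/2;
   the summand 2 k gives k a <= 1, as [expr1D_le] requires. *)
exists (8 * k ^ 2 + 2 * k).+1%N => // a a0.
have : (8 * k ^ 2 + 2 * k).+1%N%:R = 8 * k%:R ^+ 2 + 2 * k%:R + 1 :> RR.
  by rewrite -natr1 natrD !natrM.
set N := _%:R => NE aN; have k0 : 0 <= k%:R :> RR by [].
have N0 : 0 < N by rewrite NE; nra.
have ka : k%:R * a <= 1 by nra.
have := expr1D_le a0 ka; set A := _ ^+ _ => HA.
apply: (@le_trans _ _ (N * (k%:R * a) ^+ 2)); first by rewrite ler_pM2l //; lra.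
rewrite -(ler_pM2l N0).
have -> : N * (N * (k%:R * a) ^+ 2) = (k%:R * (a * N)) ^+ 2 by ring.
have aN0 : 0 <= a * N by rewrite mulr_ge0 // ltW.
have aN2 : (a * N) ^+ 2 <= 4 by nra.
rewrite exprMn; have := ler_wpM2l (sqr_ge0 k%:R) aN2; nra.
Qed.

(** The grid average replaces an integral over the box [-tau, tau]^p, and makes one [mu] serve all
    coordinates at once. The 1/2 is the discretisation error along one line. *)
Lemma fingerprinting (p n m : nat) (f : 'I_p -> Dataset p n -> Dataset p m -> RR)
    (tau L : RR) :
  0 < tau -> tau <= 1 / 2 -> (forall i x w, `|f i x w| <= 1) ->
  (forall mu i, (forall j, `|mu j| <= tau) -> mu i = tau ->
    L <= esp (cubeD mu) (f i)) ->
  (forall mu i, (forall j, `|mu j| <= tau) -> mu i = - tau ->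
    esp (cubeD mu) (f i) <= - L) ->
  exists2 mu : 'I_p -> RR, (forall j, `|mu j| <= tau) &
  p%:R * (2 * L - 1 / 2) <=
  2 * tau * \sum_i esp (cubeD mu) (fun x w => f i x w * sample_score mu i x w).
Proof.
move=> tau0 tau1 f1 f_hi f_lo.
pose corr mu i := esp (cubeD mu) (fun x w => f i x w * sample_score mu i x w).
(* Scores are at most 2, so [fine_grid] is used with a = 2 h, for which a N = 4 tau. *)
have tau2 : 2 * tau * 2 <= 2 by lra.
have [N N0 rhoN] := fine_grid (n + m).
have NR0 : 0 < N%:R :> RR by rewrite ltr0n.
pose h := 2 * tau / N%:R; have h0 : 0 < h by rewrite divr_gt0 ?mulr_gt0.
have hN : h * N%:R = 2 * tau by rewrite divfK ?gt_eqF.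
pose gr (k : nat) := - tau + h * k%:R.
have gr_tau k : (k <= N)%N -> `|gr k| <= tau.
  rewrite -(ler_nat RR) => kN; rewrite ler_norml /gr.
  by have : 0 <= k%:R :> RR by []; nra.
(* The grid indexed by [K] has only the N left endpoints of the steps. A line also reaches the last
   point [gr N], hence [k] is a natural number. *)
pose line (K : {ffun 'I_p -> 'I_N}) i k j := if j == i then gr k else gr (K j).
have line_tau K i k j : (k <= N)%N -> `|line K i k j| <= tau.
  by move=> kN; rewrite /line; case: ifP => _; apply: gr_tau => //; exact: ltnW.
pose grid (K : {ffun 'I_p -> 'I_N}) j := gr (K j).
have grid_line K i (t : 'I_N) : grid (upd K i t) = line K i t.
  by apply/funext => j; rewrite /grid /line ffunE; case: ifP.
have step K i k : (k < N)%N ->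
   esp (cubeD (line K i k.+1)) (f i) - esp (cubeD (line K i k)) (f i)
   <= h * corr (line K i k) i + 1 / 2 / N%:R.
  move=> kN; set mu := line K i k.
  have muh j : `|mu j| <= 1 / 2 by apply: le_trans (line_tau _ _ _ _ (ltnW kN)) _.
  have D0 z : 0 <= cubeD mu z.
    by apply: (cubeD_is_distr _).1 => j; apply: le_trans (muh j) _; lra.
  have va z : `|h * score (mu i) (z i)| <= h * 2.
    by rewrite normrM (gtr0_norm h0) ler_pM2l // score_norm.
  have DE z : cubeD (line K i k.+1) z =
      cubeD mu z * (1 + h * score (mu i) (z i)).
    apply: cubeD_shift => // [|j ji]; last by rewrite /mu /line (negbTE ji).
    by rewrite /mu /line eqxx /gr -natr1; ring.
  have h20 : 0 <= h * 2 by rewrite mulr_ge0 ?ltW.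
  have := esp_likelihood D0 (sum_cubeD mu) h20 va DE (f1 i).
  have -> : esp (cubeD mu) (fun x w => f i x w *
      (\sum_j h * score (mu i) (x j i) + \sum_j h * score (mu i) (w j i))) =
      h * corr mu i.
    rewrite -espZ; congr esp; apply/funext => x; apply/funext => w.
    by rewrite /sample_score -!mulr_sumr; ring.
  have : (1 + h * 2) ^+ (n + m) - 1 - (n + m)%:R * (h * 2) <= 1 / 2 / N%:R.
    by rewrite ler_pdivlMr // mulrC; apply: rhoN => //; rewrite mulrAC hN.
  by rewrite ler_norml => ? /andP[]; lra.
have tele K i : 2 * L - 1 / 2 <= h * \sum_(t < N) corr (grid (upd K i t)) i.
  have : \sum_(t < N) (esp (cubeD (line K i t.+1)) (f i) -
          esp (cubeD (line K i t)) (f i)) <=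
       \sum_(t < N) (h * corr (line K i t) i + 1 / 2 / N%:R).
    by apply: ler_sum => t _; apply: step.
  rewrite [leRHS]big_split /= -mulr_sumr sumr_const card_ord -[_ *+ N]mulr_natr divfK ?gt_eqF //.
  rewrite -(big_mkord xpredT (fun t => esp (cubeD (line K i t.+1)) (f i) -
          esp (cubeD (line K i t)) (f i))).
  rewrite (telescope_sumr (fun t => esp (cubeD (line K i t)) (f i))) //.
  have HN : L <= esp (cubeD (line K i N)) (f i).
    apply: f_hi => [j|]; first exact: line_tau.
    by rewrite /line eqxx /gr hN; ring.
  have H0 : esp (cubeD (line K i 0%N)) (f i) <= - L.
    apply: f_lo => [j|]; first exact: line_tau.
    by rewrite /line eqxx /gr mulr0 addr0.
  under [in X in _ -> X]eq_bigr do rewrite grid_line.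
  lra.
(* Summing [tele] over all [K] meets each grid point N times, and h N = 2 tau. *)
have avg i : #|{ffun 'I_p -> 'I_N}|%:R * (2 * L - 1 / 2) <=
    2 * tau * \sum_K corr (grid K) i.
  have := sum_upd (fun K => corr (grid K) i) i; rewrite card_ord => updE.
  rewrite -hN -mulrA -updE mulr_sumr mulr_natl -sumr_const.
  by apply: ler_sum => K _; exact: tele.
have [|K K0] := @sumr_ge0_ex _ {ffun 'I_p -> 'I_N} [ffun=> Ordinal N0]
    (fun K => 2 * tau * (\sum_i corr (grid K) i) - p%:R * (2 * L - 1 / 2)).
  rewrite sumrB sumr_const -mulr_sumr exchange_big subr_ge0 /= mulr_sumr.
  rewrite -[_ *+ #|_|]mulr_natl mulrCA [leLHS]mulr_natl.
  rewrite -[X in _ *+ X <= _](card_ord p) -sumr_const.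
  by apply: ler_sum => i _; exact: avg.
exists (grid K) => [j|]; first by apply: gr_tau; exact: ltnW.
by rewrite -subr_ge0.
Qed.

(** * Upper bounds on the correlations and the finite lower bound *)

(** Privacy allows sample [j] to be replaced by a fresh [t] in the input of [q] only. After
    [resample] the argument of [phi] is the fresh point, independent of the output, so [K] bounds
    its expectation. *)
Lemma private_bound (R : realFieldType) (T B : finType) (n m : nat)
    (D : T -> R) (q : {ffun 'I_n -> T} -> {ffun 'I_m -> T} -> B -> R)
    (e d M K : R) (phi : B -> T -> R) (j : 'I_n) :
  (forall z, 0 <= D z) -> \sum_z D z = 1 ->
  (forall x w b, 0 <= q x w b) -> (forall x w, \sum_b q x w b = 1) ->
  (forall x w t (Z : {set B}), \sum_(b in Z) q x w b <=
    e * (\sum_(b in Z) q (upd x j t) w b) + d) ->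
  0 <= e -> 0 <= M -> (forall b z, 0 <= phi b z <= M) ->
  (forall b, \sum_z D z * phi b z <= K) ->
  esp D (fun x w => \sum_b q x w b * phi b (x j)) <= e * K + d * M.
Proof.
move=> D0 D1 q0 q1 dp e0 M0 phiM phiK.
have P0 k (x : {ffun 'I_k -> T}) : 0 <= prodp (fun=> D) x by apply: prodp_ge0.
rewrite -[leRHS](esp_cst (n := n) (m := m) D1) /esp exchange_big.
rewrite [leRHS]exchange_big.
apply: ler_sum => w _ /=.
under eq_bigr => x _ do rewrite mulrAC.
under [leRHS]eq_bigr => x _ do rewrite mulrAC.
rewrite -!mulr_suml ler_wpM2r //.
apply: (@le_trans _ _ (\sum_(x : {ffun 'I_n -> T}) \sum_t prodp (fun=> D) x * D t *
    (e * (\sum_b q (upd x j t) w b * phi b (x j)) + d * M))).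
  apply: ler_sum => x _; set F := \sum_b _.
  have -> : prodp (fun=> D) x * F = \sum_t prodp (fun=> D) x * D t * F.
    by rewrite -mulr_suml -mulr_sumr D1 mulr1.
  apply: ler_sum => t _; rewrite ler_wpM2l ?mulr_ge0 //.
  by apply: dp_expectation => // Z; exact: dp.
rewrite (resample (fun=> D) (fun x z => e * (\sum_b q x w b * phi b z) + d * M)).
rewrite [leRHS]mulr_suml; apply: ler_sum => x _.
under eq_bigr => t _ do rewrite -mulrA.
rewrite -mulr_sumr ler_wpM2l //.
under eq_bigr => t _ do rewrite mulrDr.
rewrite big_split /= -mulr_suml D1 mul1r lerD2r.
under eq_bigr => t _ do rewrite mulrCA.
rewrite -mulr_sumr ler_wpM2l //.
under eq_bigr => t _ do rewrite mulr_sumr.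
rewrite exchange_big /= -[K]mul1r -(q1 x w) mulr_suml.
apply: ler_sum => b _; under eq_bigr => t _ do rewrite mulrCA.
by rewrite -mulr_sumr ler_wpM2l.
Qed.

Lemma cubeD_score_norm (p : nat) (mu : 'I_p -> RR) (b : Cube p) :
  (forall i, `|mu i| <= 1 / 2) ->
  \sum_z cubeD mu z * `|\sum_i sg (b i) * score (mu i) (z i)| <=
  3 / 2 * Num.sqrt p%:R.
Proof.
move=> muh.
have D0 z : 0 <= cubeD mu z.
  by apply: (cubeD_is_distr _).1 => j; apply: le_trans (muh j) _; lra.
(* The weight 1 / sqrt p, which balances the second moment bound 2 p in [sum_norm_le_sqr], is
   positive only for p > 0. *)
case: (posnP p) => [p0|p0].
  subst p; rewrite big1 ?mulr_ge0 ?sqrtr_ge0 // => z _.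
  by rewrite big_ord0 normr0 mulr0.
have s0 : 0 < Num.sqrt (p%:R : RR) by rewrite sqrtr_gt0 ltr0n.
apply: le_trans (@sum_norm_le_sqr _ _ _ _ (Num.sqrt p%:R)^-1 (2 * p%:R) D0
  (sum_cubeD mu) _ _) _; first by rewrite invr_gt0.
  rewrite (sum_prodp_sqr (fun i => sum_bern (mu i))
      (v := fun i c => sg (b i) * score (mu i) c)).
    apply: (@le_trans _ _ (\sum_(i < p) 2)).
      apply: ler_sum => i _; apply: le_trans (sum_bern_score_sqr (muh i)).
      apply: ler_sum => c _; rewrite exprMn.
      by have -> : sg (b i) ^+ 2 = 1; [case: (b i); rewrite /= ?sqrrN expr1n|rewrite mul1r].
    by rewrite sumr_const card_ord mulr_natr.
  move=> i; under eq_bigr => c _ do rewrite mulrCA.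
  by rewrite -mulr_sumr sum_bern_score ?mulr0.
rewrite invrK; set s := Num.sqrt _ in s0 *.
have -> : p%:R = s ^+ 2 :> RR by rewrite /s sqr_sqrtr.
have -> : (s^-1 * (2 * s ^+ 2) + s) / 2 = 3 / 2 * s by field; rewrite gt_eqF.
by [].
Qed.

(** Leaving [l] free keeps the bound linear in [m]; it is later set to 16 alpha. *)
Lemma public_score_norm (p n m : nat) (mu : 'I_p -> RR) i (l : RR) :
  (forall i, `|mu i| <= 1 / 2) -> 0 < l ->
  esp (cubeD mu) (fun (x : Dataset p n) (w : Dataset p m) =>
    `|\sum_j score (mu i) (w j i)|) <= (l * (2 * m%:R) + l^-1) / 2.
Proof.
move=> muh l0.
have D0 z : 0 <= cubeD mu z.
  by apply: (cubeD_is_distr _).1 => j; apply: le_trans (muh j) _; lra.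
have D1 := sum_cubeD mu.
rewrite (esp_public D1 (fun w : Dataset p m => `|\sum_j score (mu i) (w j i)|)).
apply: sum_norm_le_sqr => //; first by move=> w; apply: prodp_ge0.
  exact: (sum_prodp (fun=> D1)).
rewrite (sum_prodp_sqr (fun=> D1) (v := fun _ z => score (mu i) (z i))).
  apply: (@le_trans _ _ (\sum_(j < m) 2)).
    apply: ler_sum => j _; rewrite (cubeD_marginal mu (fun c => score (mu i) c ^+ 2)).
    exact: sum_bern_score_sqr.
  by rewrite sumr_const card_ord mulr_natr.
by move=> _; rewrite (cubeD_marginal mu (score (mu i))) sum_bern_score.
Qed.

Lemma sign_release_lower_bound (p n m : nat) (alpha e : RR)
    (q : Dataset p n -> Dataset p m -> Cube p -> RR) :
  0 < alpha -> alpha <= 1 / 16 -> (0 < n)%N -> 0 <= e ->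
  (forall x w b, 0 <= q x w b) -> (forall x w, \sum_b q x w b = 1) ->
  (forall x x' w (Z : {set Cube p}), neighbors x x' ->
    \sum_(b in Z) q x w b <= e * (\sum_(b in Z) q x' w b) + 1 / (4 * n%:R)) ->
  (forall D i c, is_distr D -> stump_mean D i = sg c * (2 * alpha) ->
    1 - 2 * alpha <= sg c * esp D (fun x w => \sum_b q x w b * sg (b i))) ->
  m%:R <= 512^-1 / alpha ^+ 2 ->
  Num.sqrt p%:R <= 12 * e * alpha * n%:R.
Proof.
move=> a0 a1 n0 e0 q0 q1 dp acc hm.
pose f (i : 'I_p) x w := \sum_b q x w b * sg (b i).
have f1 i x w : `|f i x w| <= 1.
  rewrite -(q1 x w); apply: le_trans (ler_norm_sum _ _ _) _.
  by apply: ler_sum => b _; rewrite normrM sg_norm mulr1 ger0_norm.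
have tau0 : 0 < 2 * alpha by lra.
have tau1 : 2 * alpha <= 1 / 2 by lra.
have distr mu : (forall j, `|mu j| <= 2 * alpha) -> is_distr (@cubeD p mu).
  by move=> muh; apply: cubeD_is_distr => j; apply: le_trans (muh j) _; lra.
have [|mu i muh mui|mu muh] := fingerprinting tau0 tau1 f1 (L := 1 - 2 * alpha).
- move=> mu i muh mui; rewrite -[leRHS]mul1r.
  by apply: (acc _ _ true (distr _ muh)); rewrite cubeD_mean mul1r.
- rewrite lerNr -[leRHS]mulN1r.
  by apply: (acc _ _ false (distr _ muh)); rewrite cubeD_mean mulN1r.
have muh2 i : `|mu i| <= 1 / 2 by apply: le_trans (muh i) _.
have [D0 D1] := distr _ muh.
pose T (b z : Cube p) := \sum_i sg (b i) * score (mu i) (z i).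
(* The private part is grouped by samples, since privacy concerns one sample at a time; the public
   part stays grouped by coordinates. *)
have split_score : \sum_i esp (cubeD mu) (fun x w => f i x w * sample_score mu i x w) =
   \sum_j esp (cubeD mu) (fun x w => \sum_b q x w b * T b (x j)) +
   \sum_i esp (cubeD mu) (fun x w => f i x w * \sum_j score (mu i) (w j i)).
  rewrite -!esp_sum -espD; congr esp; apply/funext => x; apply/funext => w.
  under eq_bigr => i _ do rewrite /sample_score mulrDr.
  rewrite big_split; congr (_ + _) => /=.
  under eq_bigr => i _ do rewrite mulr_sumr.
  rewrite exchange_big; apply: eq_bigr => j _ /=.
  under eq_bigr => i _ do rewrite /f mulr_suml.
  rewrite exchange_big; apply: eq_bigr => b _ /=.
  by rewrite /T mulr_sumr; apply: eq_bigr => i _; rewrite mulrA.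
have T_le b z : `|T b z| <= 2 * p%:R.
  apply: le_trans (ler_norm_sum _ _ _) _.
  rewrite mulr_natr -[X in _ *+ X](card_ord p) -sumr_const; apply: ler_sum => i _.
  by rewrite normrM sg_norm mul1r score_norm.
have private j : esp (cubeD mu) (fun x w => \sum_b q x w b * T b (x j)) <=
    e * (3 / 2 * Num.sqrt p%:R) + 1 / (4 * n%:R) * (2 * p%:R).
  (* [private_bound] needs a nonnegative test function, hence the absolute value. *)
  apply: (@le_trans _ _
     (esp (cubeD mu) (fun x w => \sum_b q x w b * `|T b (x j)|))).
    by apply: esp_le => // x w; apply: ler_sum => b _; rewrite ler_wpM2l // ler_norm.
  apply: (private_bound (phi := fun b z => `|T b z|)) => //.
  - move=> x w t Z; apply: dp; exists j => k kj.
    by rewrite ffunE (negbTE kj).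
  - by move=> b z; rewrite normr_ge0 T_le.
  - by move=> b; exact: cubeD_score_norm.
have public i : esp (cubeD mu) (fun x w => f i x w * \sum_j score (mu i) (w j i)) <=
    (16 * alpha * (2 * m%:R) + (16 * alpha)^-1) / 2.
  apply: le_trans (@public_score_norm p n m mu i (16 * alpha) muh2 _); last by lra.
  apply: esp_le => // x w; apply: le_trans (ler_norm _) _.
  by rewrite normrM ler_piMl.
rewrite split_score.
have sum_le k (F : 'I_k -> RR) c : (forall i, F i <= c) -> \sum_i F i <= k%:R * c.
  by move=> Fc; rewrite mulr_natl -[X in _ *+ X](card_ord k) -sumr_const ler_sum.
have {private} := sum_le _ _ _ private; have {public} := sum_le _ _ _ public.
set U := \sum_i _ => HU; set V := \sum_j _ => HV.
set s := Num.sqrt _ in HV *; set k := n%:R in HV *.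
have k0 : 0 < k by rewrite /k ltr0n.
have s0 : 0 <= s by exact: sqrtr_ge0.
have ps : p%:R = s ^+ 2 :> RR by rewrite /s sqr_sqrtr.
rewrite ps in HU HV *.
move=> H.
have a4 : 0 <= 4 * alpha by lra.
(* With delta = 1 / (4 n), the delta terms of all n samples add up to p / 2. *)
have {}HV : V <= 3 / 2 * k * e * s + s ^+ 2 / 2.
  apply: le_trans HV _; rewrite le_eqVlt; apply/orP; left; apply/eqP.
  by field; rewrite gt_eqF.
have {}HU : 4 * alpha * U <= s ^+ 2 / 4.
  have hm' : alpha ^+ 2 * m%:R <= 512^-1.
    by rewrite mulrC -ler_pdivlMr ?exprn_gt0.
  apply: le_trans (ler_wpM2l a4 HU) _.
  (* The choice 16 alpha makes both summands at most 1/8 when alpha^2 m <= 1/512. *)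
  have -> : 4 * alpha * (s ^+ 2 * ((16 * alpha * (2 * m%:R) + (16 * alpha)^-1) / 2)) =
     s ^+ 2 * (64 * (alpha ^+ 2 * m%:R) + 1 / 8).
    by field; rewrite gt_eqF.
  by rewrite ler_wpM2l ?sqr_ge0 //; lra.
have [->|sn0] := eqVneq s 0; first by rewrite !mulr_ge0 // ltW.
have {sn0}s_gt0 : 0 < s by rewrite lt_def sn0.
(* After subtracting the public and delta terms, at least half of s^2 remains on the left, against 6
   alpha n e s; this gives the constant 12. *)
rewrite -(ler_pM2l s_gt0).
have s2 : 0 <= s ^+ 2 by exact: sqr_ge0.
have as2 : alpha * s ^+ 2 <= 1 / 16 * s ^+ 2 by rewrite ler_wpM2r.
have aV : 4 * alpha * V <= 6 * (alpha * k * e * s) + 2 * (alpha * s ^+ 2).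
  by apply: le_trans (ler_wpM2l a4 HV) _; rewrite le_eqVlt; apply/orP; left; apply/eqP; field.
have E0 : 0 <= alpha * k * e * s by rewrite !mulr_ge0 // ltW.
have -> : s * (12 * e * alpha * k) = 12 * (alpha * k * e * s) by ring.
rewrite -expr2; move: H.
have -> : 2 * (2 * alpha) * (V + U) = 4 * alpha * V + 4 * alpha * U by ring.
have -> : s ^+ 2 * (2 * (1 - 2 * alpha) - 1 / 2) = 3 / 2 * s ^+ 2 - 4 * (alpha * s ^+ 2).
  by field.
lra.
Qed.

(** * Reduction of measurable outputs to sign vectors *)

Definition sign_vector (p : nat) (G : Out p) : Cube p := [ffun i => 0 < G i].

Definition sign_fiber (p : nat) (b : Cube p) : set (Out p) :=
  [set G | sign_vector G = b].

Lemma measurable_coord (p : nat) (i : 'I_p) (B : set RR) :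
  @measurable _ (measurableTypeR RR) B -> measurable [set G : Out p | B (G i)].
Proof. by move=> mB; apply: sub_sigma_algebra; exists i, B. Qed.

Lemma measurable_accurate_event (p : nat) (D : Cube p -> RR) (alpha : RR) :
  measurable (accurate_event D alpha).
Proof.
have -> : accurate_event D alpha =
    (\bigcap_(i in [set: 'I_p])
      [set G : Out p | [set` `[stump_mean D i - alpha, stump_mean D i + alpha]] (G i)]).
  apply/seteqP; split => [G GD i _|G GD i]; first by
    rewrite /= in_itv /= -ler_distl GD.
  by have := GD i I; rewrite /= in_itv /= -ler_distl.
apply: fin_bigcap_measurable => // i _; apply: measurable_coord.
exact: measurable_itv.
Qed.

Lemma measurable_sign_fiber (p : nat) (b : Cube p) : measurable (sign_fiber b).
Proof.
have -> : sign_fiber b = (\bigcap_(i in [set: 'I_p])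
    [set G : Out p | [set` if b i then `]0, +oo[ else `]-oo, 0]] (G i)]).
  apply/seteqP; split => [G <- i _|G Gb].
    by rewrite /= ffunE; case: ltP => G0 /=; rewrite in_itv /= ?andbT.
  apply/ffunP => i; rewrite ffunE; have := Gb i I.
  by case: (b i); rewrite /= in_itv /= ?andbT // ltNge => ->.
apply: fin_bigcap_measurable => // i _; apply: measurable_coord.
by case: (b i); exact: measurable_itv.
Qed.

Lemma bigcup_sign_fiber (p : nat) (Z : {set Cube p}) :
  [set G : Out p | sign_vector G \in Z] = (\bigcup_(b in [set` Z]) sign_fiber b).
Proof.
by apply/seteqP; split => [G GZ|G [b bZ /= ->] //]; exists (sign_vector G).
Qed.

Lemma measurable_sign_vector (p : nat) (Z : {set Cube p}) :
  measurable [set G : Out p | sign_vector G \in Z].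
Proof.
rewrite bigcup_sign_fiber; apply: fin_bigcup_measurable => // b _.
exact: measurable_sign_fiber.
Qed.

(** Finite additivity over the disjoint sign fibers turns a probability on [Out p] into real weights
    on the finite cube. *)
Lemma sign_vector_law (p : nat) (P : probability (Out p) RR) (Z : {set Cube p}) :
  P [set G : Out p | sign_vector G \in Z] = (\sum_(b in Z) fine (P (sign_fiber b)))%:E.
Proof.
rewrite bigcup_sign_fiber measure_fin_bigcup //; last 2 first.
- by move=> b b' _ _ [G [/= <- <-]].
- by move=> b _; exact: measurable_sign_fiber.
rewrite -sumEFin (bigfs _ (index_enum_uniq _)).
  by apply: eq_fsbigr => b _; rewrite fineK // fin_num_measure //; exact: measurable_sign_fiber.
by move=> b _; rewrite mem_index_enum.
Qed.

Section SignAlgorithm.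
Variables (p n m : nat) (A : PAPAlg p n m).

Definition sign_law x w (b : Cube p) : RR := fine (A x w (sign_fiber b)).

Lemma sign_law_ge0 x w b : 0 <= sign_law x w b.
Proof. by rewrite fine_ge0. Qed.

Lemma sum_sign_law x w : \sum_b sign_law x w b = 1.
Proof.
have := sign_vector_law (A x w) [set: Cube p]%SET.
rewrite (eq_bigl xpredT) => [|b]; last by rewrite inE.
rewrite (_ : [set G : Out p | _] = [set: Out p]); last first.
  by apply/seteqP; split => // G _ /=; rewrite inE.
by rewrite probability_setT => -[].
Qed.

Lemma sign_law_dp (eps delta : RR) x x' w (Z : {set Cube p}) :
  DP_private A eps delta -> neighbors x x' ->
  \sum_(b in Z) sign_law x w b <=
    expR eps * (\sum_(b in Z) sign_law x' w b) + delta.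
Proof.
move=> dp xx'; have := dp w x x' xx' _ (measurable_sign_vector Z).
by rewrite !sign_vector_law -EFinM -EFinD lee_fin.
Qed.

(** The sign is correct with probability at least 1 - alpha, and its correlation with [sg c] is
    twice that probability minus 1. *)
Lemma sign_law_accurate (alpha : RR) (D : Cube p -> RR) (i : 'I_p) (c : bool) :
  accurate A alpha alpha -> is_distr D ->
  (forall G, accurate_event D alpha G -> (0 < G i) = c) ->
  1 - 2 * alpha <=
    sg c * esp D (fun x w => \sum_b sign_law x w b * sg (b i)).
Proof.
move=> acc distrD accE; have [D0 D1] := distrD.
pose h x w := \sum_(b in [set b : Cube p | b i == c]%SET) sign_law x w b.
have hP : 1 - alpha <= esp D h.
  rewrite -lee_fin; apply: le_trans (acc D distrD) _.
  rewrite /esp -sumEFin; apply: lee_sum => x _.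
  rewrite -sumEFin; apply: lee_sum => w _.
  rewrite [in leRHS]EFinM; apply: lee_wpmul2l.
    by rewrite lee_fin; apply: mulr_ge0; apply: prodr_ge0.
  rewrite /h -sign_vector_law; apply: le_measure.
  - by rewrite inE; exact: measurable_accurate_event.
  - by rewrite inE; exact: measurable_sign_vector.
  - by move=> G GD; rewrite /= inE ffunE (accE G GD).
have -> : sg c * esp D (fun x w => \sum_b sign_law x w b * sg (b i)) =
    2 * esp D h + -1.
  rewrite -[X in _ + X](esp_cst (n := n) (m := m) D1) -!espZ -espD.
  congr esp; apply/funext => x; apply/funext => w.
  rewrite /h !mulr_sumr -[X in - X](sum_sign_law x w) -sumrN.
  rewrite [X in _ = X + _]big_mkcond -big_split.
  apply: eq_bigr => b _; rewrite inE.
  case: (b i); case: c {accE h hP}; rewrite /=; ring.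
lra.
Qed.

End SignAlgorithm.

Theorem theorem4p2 :
  exists (alpha0 c : RR) (k : nat), 0 < alpha0 /\ 0 < c /\
  forall (p n m : nat) (alpha : RR) (A : PAPAlg p n m),
    0 < alpha -> alpha <= alpha0 -> (0 < n)%N ->
    outputs_in_range A ->
    DP_private A 1 (1 / (4 * n%:R)) ->
    accurate A alpha alpha ->
    c * Num.sqrt (p%:R) / alpha <= n%:R * (ln (2 + p%:R + alpha^-1)) ^+ k
    \/ c / alpha ^+ 2 <= m%:R.
Proof.
have e1 : 1 <= expR 1 :> RR by have := expR_ge1Dx (1 : RR); lra.
(* The public budget gives 512 and the privacy factor gives [expR 1]; the exponent 0 means that no
   logarithm is lost. *)
exists (1 / 16), (512 * expR 1)^-1, 0%N; split; first by lra.
split; first by rewrite invr_gt0 mulr_gt0 // expR_gt0.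
move=> p n m alpha A a0 a1 n0 _ dp acc.
have c0 : 0 < 512 * expR 1 :> RR by rewrite mulr_gt0 // expR_gt0.
have [|mlt] := leP ((512 * expR 1)^-1 / alpha ^+ 2) m%:R; [by right|left].
rewrite expr0 mulr1 ler_pdivrMr // mulrC ler_pdivrMr //.
have : Num.sqrt p%:R <= 12 * expR 1 * alpha * n%:R.
  apply: (sign_release_lower_bound (m := m) (q := sign_law A)) => //.
  - exact: sign_law_ge0.
  - exact: sum_sign_law.
  - by move=> x x' w Z; exact: sign_law_dp.
  (* An answer within alpha of a mean 2 alpha or -2 alpha has the sign of that mean. *)
  - move=> D i c distrD Di; apply: sign_law_accurate => // G /(_ i).
    rewrite Di ler_distl; case: c {Di} => /andP[/= ? ?].
      by apply/idP; lra.
    by apply/negbTE; rewrite -leNgt; lra.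
  - apply: (le_trans (ltW mlt)); rewrite ler_wpM2r //.
      by rewrite invr_ge0 sqr_ge0.
    by rewrite lef_pV2 ?posrE //; lra.
have : 0 <= expR 1 * alpha * n%:R :> RR by rewrite !mulr_ge0 // ltW // expR_gt0.
by move=> ? ?; lra.
Qed.
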